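(* Let $G$ be a finite noncyclic nilpotent group of order $n=p_1^{\alpha_1}p_2^{\alpha_2}p_3^{\alpha_3}$, where $p_1<p_2<p_3$ are primes and $\alpha_i\geq1$. For $i\in\{1,2,3\}$ let $P_i$ be the unique Sylow $p_i$-subgroup of $G$, and suppose that the center $Z(P_j)$ is noncyclic for every $j\in\{1,2,3\}$. Then $\delta(\mathcal{P}(G))=\deg(y)$, where $\langle y\rangle\in\mathcal{M}(G)$ is of minimum order.
   Context: For a finite group $G$, the power graph $\mathcal{P}(G)$ is the simple graph with vertex set $G$ in which two distinct vertices are adjacent iff one is a positive power of the other. $\deg(v)$ denotes the degree of a vertex $v$ in $\mathcal{P}(G)$ and $\delta(\mathcal{P}(G))=\min_{v\in G}\deg(v)$. A cyclic subgroup of $G$ is maximal cyclic if it is not properly contained in any cyclic subgroup of $G$; $\mathcal{M}(G)$ denotes the set of maximal cyclic subgroups of $G$. *)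

(* Defs.v *)
From mathcomp Require Import all_boot all_order all_fingroup all_solvable.
Set Implicit Arguments.
Unset Strict Implicit.
Unset Printing Implicit Defensive.

Local Open Scope group_scope.

(* y is a positive power of x. Exponents 1, ..., #[x] suffice; pos_powerP gives
   the form with an arbitrary positive exponent. *)
Definition pos_power (gT : finGroupType) (x y : gT) : bool :=
  [exists k : 'I_#[x], y == x ^+ k.+1].

Lemma pos_powerP (gT : finGroupType) (x y : gT) :
  reflect (exists2 k, 0 < k & y = x ^+ k) (pos_power x y).
Proof.
apply: (iffP existsP) => [[k /eqP ->] | [k k_gt0 ->]]; first by exists k.+1.
have lt_k : k.-1 %% #[x] < #[x] by rewrite ltn_mod order_gt0.
exists (Ordinal lt_k); rewrite -{1}(prednK k_gt0) !expgS.
by rewrite expg_mod ?expg_order.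
Qed.

Definition power_adj (gT : finGroupType) (x y : gT) : bool :=
  (x != y) && (pos_power x y || pos_power y x).

Definition power_deg (gT : finGroupType) (G : {group gT}) (v : gT) : nat :=
  #|[set w in G | power_adj v w]|.

Definition power_min_deg (gT : finGroupType) (G : {group gT}) : nat :=
  power_deg G [arg min_(v < 1 in G) power_deg G v].

Definition max_cyclics (gT : finGroupType) (G : {group gT}) :
    {set {group gT}} :=
  [set M : {group gT} | [max M | (M \subset G) && cyclic M]].

(* Main.v *)
(* The closed neighbourhood of x in the power graph consists of <x> and of the
   generators of the cyclic overgroups of x; for y generating a maximal cyclic
   subgroup it is just <y>.  So it suffices to show that this neighbourhood has
   at least |<w>| elements whenever <w> is a maximal cyclic subgroup containing
   x.  Write q_i, e_i for the orders of the p_i-parts w_i, x_i of w, x, and L_i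
   for the number of elements g of <w_i> with x_i in <g>.  As Z(P_i) is not
   cyclic, there is a central z of order p_i outside <w>, and all products
   g z^k h with g in <w_i> \ <x_i> and h in the p_i'-part of <w> above that of x
   are above x and outside <x>.  Hence the neighbourhood has at least
   e_1 e_2 e_3 + p_i (q_i - e_i) L_j L_k elements.  Since
   L_j >= q_j - e_j / p_j, choosing i as the largest index with e_i < q_i gives
   q_1 q_2 q_3; the tight case rests on
   p_i (1 - 1/p_j) (1 - 1/p_k) >= 1, e.g. 2 (2/3) (4/5) = 16/15. *)
Require Import Defs.
From mathcomp Require Import all_boot all_order all_fingroup all_solvable.
From mathcomp Require Import zify.

Set Implicit Arguments.
Unset Strict Implicit.
Unset Printing Implicit Defensive.

Local Open Scope group_scope.

Definition power_nbhd (gT : finGroupType) (G : {group gT}) (x : gT) : {set gT} :=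
  [set v in G | (v \in <[x]>) || (x \in <[v]>)].

Definition cycle_above (gT : finGroupType) (w x : gT) : {set gT} :=
  [set g in <[w]> | x \in <[g]>].

Section CyclicCounting.

Variable gT : finGroupType.
Implicit Types (G H K : {group gT}) (x y w u v s t g h z : gT).

Lemma pos_power_cycle x y : pos_power x y = (y \in <[x]>).
Proof.
apply/pos_powerP/cycleP => [[k _ ->]|[k ->]]; first by exists k.
exists (k + #[x])%N; first by rewrite addn_gt0 order_gt0 orbT.
by rewrite expgD expg_order mulg1.
Qed.

Lemma power_degS G x : x \in G -> (power_deg G x).+1 = #|power_nbhd G x|.
Proof.
move=> Gx; rewrite (cardsD1 x) inE Gx cycle_id add1n; congr _.+1.
apply: eq_card => v; rewrite !inE /power_adj !pos_power_cycle eq_sym.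
by rewrite andbCA.
Qed.

Lemma power_nbhd_max y G : <[y]>%G \in max_cyclics G ->
  power_nbhd G y = <[y]>.
Proof.
rewrite inE => /maxgroupP [/andP[sG _] ymax]; apply/setP=> v; rewrite inE.
apply/andP/idP=> [[Gv /orP[//|yv]]|yv]; last by rewrite yv (subsetP sG).
have /= <- := ymax <[v]>%G; rewrite ?cycle_id ?cycle_cyclic ?andbT //=.
  by rewrite cycle_subG.
by rewrite cycle_subG.
Qed.

Lemma max_cyclics_above G x : x \in G ->
  exists w, [/\ <[w]>%G \in max_cyclics G, w \in G & x \in <[w]>].
Proof.
pose cycG := [pred M : {group gT} | (M \subset G) && cyclic M].
move=> Gx; have [|M Mmax sxM] := @maxgroup_exists _ cycG <[x]>%G.
  by rewrite /= cycle_subG Gx cycle_cyclic.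
have /maxgroupp/andP[sMG /cyclicP[w defM]] := Mmax.
have eM : M = <[w]>%G by apply: val_inj.
rewrite {}eM in Mmax sMG sxM; exists w; rewrite inE.
by rewrite -cycle_subG sMG -cycle_subG.
Qed.

Lemma commute_cycles u v g h :
  commute u v -> g \in <[u]> -> h \in <[v]> -> commute g h.
Proof.
move=> cuv /cycleP[i ->] /cycleP[j ->].
exact/commuteX/commute_sym/commuteX/commute_sym.
Qed.

Lemma mulg_TI_inj H K (a a' b b' : gT) : H :&: K = 1 ->
  a \in H -> a' \in H -> b \in K -> b' \in K -> a * b = a' * b' ->
  a = a' /\ b = b'.
Proof.
move=> tiHK Ha Ha' Kb Kb' e.
have e1 : a'^-1 * a = b' * b^-1.
  by apply: (mulgI a'); rewrite mulKVg mulgA -e mulgK.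
have: a'^-1 * a \in H :&: K by rewrite inE {2}e1 !groupM ?groupV.
rewrite tiHK => /set1P/eqP; rewrite -eq_mulVg1 => /eqP eaa.
by split=> //; apply: (mulgI a); rewrite e eaa.
Qed.

Lemma card_mulg_TI H K (A B : {set gT}) :
  A \subset H -> B \subset K -> H :&: K = 1 -> #|A * B| = (#|A| * #|B|)%N.
Proof.
move=> /subsetP sAH /subsetP sBK tiHK; rewrite -cardsX.
have -> : A * B = [set ab.1 * ab.2 | ab in setX A B].
  apply/setP=> g; apply/mulsgP/imsetP=> [[a b Aa Bb ->]|].
    by exists (a, b) => //; apply/setXP.
  by case=> -[a b] /setXP[Aa Bb] ->; exists a b.
rewrite card_in_imset // => -[a b] [a' b'].
move=> /setXP[/sAH Ha /sBK Kb] /setXP[/sAH Ha' /sBK Kb'] e.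
by have [/= -> ->] := mulg_TI_inj tiHK Ha Ha' Kb Kb' e.
Qed.

Lemma mem_cycleX_pelt p u s g : prime p -> p.-elt u -> s \in <[u]> ->
  g \in <[u]> -> g \notin <[s]> -> s \in <[g ^+ p]>.
Proof.
move=> pr_p pu us ug sg.
have ps : p.-elt s := mem_p_elt pu us.
have pg : p.-elt g := mem_p_elt pu ug.
have [a oa] := p_natP ps; have [b ob] := p_natP pg.
have cy := cycle_cyclic u.
have ltab : (a < b)%N.
  rewrite ltnNge; apply: contra sg => leba.
  rewrite -cycle_subG -(cardSg_cyclic cy) ?cycle_subG //.
  by rewrite -!orderE oa ob dvdn_exp2l.
rewrite -cycle_subG -(cardSg_cyclic cy) ?cycle_subG ?groupX //.
rewrite -!orderE orderXdiv ob; last by rewrite dvdn_exp // (leq_trans _ ltab).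
case: b ltab {ob} => // b ltab; rewrite expnS mulKn ?prime_gt0 //.
by rewrite oa dvdn_exp2l.
Qed.

Lemma card_cycle_above p u s : prime p -> p.-elt u -> s \in <[u]> ->
  (p * (#[u] - #|cycle_above u s|) <= #[s])%N.
Proof.
move=> pr_p pu us.
have -> : (#[u] - #|cycle_above u s|)%N = #|<[u]> :\: cycle_above u s|.
  rewrite orderE cardsD (setIidPr _) //.
  by apply/subsetP=> g; rewrite inE => /andP[].
have [->|s1] := eqVneq s 1.
  rewrite (_ : _ :\: _ = set0) ?cards0 ?muln0 //; apply/setP=> g.
  by rewrite !inE group1 andbT andNb.
have ps : p.-elt s := mem_p_elt pu us.
have dv : p %| #[s] by case/pgroup_pdiv: ps => //; rewrite cycle_eq1.
rewrite -(divnK dv) mulnC leq_mul2r orderE -orderXdiv //.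
rewrite orderE subset_leq_card ?orbT //.
apply/subsetP=> g; rewrite !inE andbC => /andP[ug]; rewrite ug /= => sg.
exact: (mem_cycleX_pelt pr_p pu ug us).
Qed.

Lemma cycle_aboveM u v s t : commute u v -> coprime #[u] #[v] ->
  s \in <[u]> -> t \in <[v]> ->
  (#|cycle_above u s| * #|cycle_above v t| <= #|cycle_above (u * v) (s * t)|)%N.
Proof.
move=> cuv co us vt.
rewrite -(@card_mulg_TI <[u]>%G <[v]>%G) /=; first last.
- by apply: coprime_TIg; rewrite -!orderE.
- by apply/subsetP=> g; rewrite inE => /andP[].
- by apply/subsetP=> g; rewrite inE => /andP[].
apply/subset_leq_card/subsetP=> k /mulsgP[g h].
rewrite !inE => /andP[ug sg] /andP[vh th] ->{k}.
have cgh : commute g h := commute_cycles cuv ug vh.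
have cogh : coprime #[g] #[h].
  apply: coprime_dvdl (order_dvdG ug) _.
  by apply: coprime_dvdr (order_dvdG vh) _; rewrite -!orderE.
by rewrite !cycleM // !mem_mulg.
Qed.

(* Multiplying by the powers of [z] does not change the [p]-th power of the
   [p]-part, so each element of <[u]> outside <[s]> yields [p] elements
   above [s]. *)
Lemma power_nbhd_lower_bound G p u v s t z : prime p -> u \in G -> v \in G ->
  commute u v -> p.-elt u -> p^'.-elt v -> s \in <[u]> -> t \in <[v]> ->
  z \in 'Z(G) -> #[z] = p -> z \notin <[u]> ->
  (#[s] * #[t] + p * (#[u] - #[s]) * #|cycle_above v t|
    <= #|power_nbhd G (s * t)|)%N.
Proof.
move=> pr_p Gu Gv cuv pu pv us vt /centerP[Gz zC] oz zu.
have sGu : <[u]> \subset G by rewrite cycle_subG.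
have sGv : <[v]> \subset G by rewrite cycle_subG.
have sGz : <[z]> \subset G by rewrite cycle_subG.
have czu : <[z]> \subset 'C(<[u]>).
  by rewrite cent_cycle cycle_subG; apply/cent1P; apply: zC.
have Tuz : <[u]> :&: <[z]> = 1.
  by rewrite setIC; apply: prime_TIg; rewrite -?orderE ?oz // cycle_subG.
have pK : p.-group (<[u]> <*> <[z]>).
  by rewrite (cent_joinEr czu) pgroupM /pgroup -!orderE oz pnat_id ?andbT.
have TKv : (<[u]> <*> <[z]>) :&: <[v]> = 1.
  by apply: coprime_TIg; apply: pnat_coprime pK pv.
have cst : commute s t := commute_cycles cuv us vt.
have co_st : coprime #[s] #[t].
  apply: (@pnat_coprime p); first exact: mem_p_elt pu us.
  exact: mem_p_elt pv vt.
set A := (<[u]> :\: <[s]>) * <[z]>; set B := cycle_above v t.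
have sAK : A \subset <[u]> <*> <[z]>.
  by rewrite (cent_joinEr czu) mulSg ?subsetDl.
have sBv : B \subset <[v]> by apply/subsetP=> g; rewrite inE => /andP[].
have cardA : #|A| = (p * (#[u] - #[s]))%N.
  rewrite (@card_mulg_TI <[u]>%G <[z]>%G) ?subsetDl //= -orderE oz mulnC.
  by rewrite cardsD (setIidPr _) ?cycle_subG // -!orderE.
have Tst : [disjoint <[s * t]> & A * B].
  rewrite disjoint_subset; apply/subsetP=> d.
  rewrite cycleM // => /mulsgP[a b sa tb ->{d}].
  rewrite !inE; apply/negP=> /mulsgP[k h Ak Bh e].
  have ua : a \in <[u]> by move: sa; apply/subsetP; rewrite cycle_subG.
  have vb : b \in <[v]> by move: tb; apply/subsetP; rewrite cycle_subG.
  have [|ak _] := mulg_TI_inj TKv _ (subsetP sAK k Ak) vb (subsetP sBv h Bh) e.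
    exact: (subsetP (joing_subl _ _)).
  case/mulsgP: Ak => g y; rewrite inE => /andP[sg ug] zy eky.
  have: y \in <[u]> :&: <[z]>.
    by rewrite inE zy -(mulKg g y) -eky -ak groupM ?groupV.
  rewrite Tuz => /set1P y1; move: sg; rewrite (_ : g = a) ?sa //.
  by rewrite ak eky y1 mulg1.
rewrite -orderM // -cardA -(@card_mulg_TI (<[u]> <*> <[z]>)%G <[v]>%G) // orderE.
have := leq_card_setU <[s * t]> (A * B); rewrite /leqif Tst => -[_ /eqP <-].
apply/subset_leq_card/subsetP=> k; rewrite !inE => /orP[stk|].
  rewrite stk andbT; move: stk; apply/subsetP; rewrite cycle_subG groupM //.
    exact: (subsetP sGu).
  exact: (subsetP sGv).
case/mulsgP=> a h Aa Bh ->{k}.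
have Ka := subsetP sAK a Aa; have vh := subsetP sBv h Bh.
have Ga : a \in G.
  by move: Ka; apply/subsetP; rewrite join_subG sGu.
have Gh : h \in G := subsetP sGv h vh.
rewrite groupM //=; apply/orP; right.
have th : t \in <[h]> by move: Bh; rewrite inE => /andP[].
case/mulsgP: Aa => g y; rewrite inE => /andP[sg ug] zy ea.
have cgh : commute g h := commute_cycles cuv ug vh.
have /cycleP[j ey] := zy.
have czg k : k \in G -> commute y k.
  by move=> Gk; rewrite ey; apply/commute_sym/commuteX/commute_sym/zC.
have cah : commute a h.
  by rewrite ea; apply: commute_sym; apply: commuteM; apply: commute_sym => //; apply: czg.
have coah : coprime #[a] #[h].
  apply: (@pnat_coprime p); first exact: mem_p_elt pK Ka.
  exact: mem_p_elt pv vh.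
rewrite cycleM // mem_mulg //.
have sgp := mem_cycleX_pelt pr_p pu us ug sg.
have egp : g ^+ p = a ^+ p.
  rewrite ea expgMn; last by apply: commute_sym; apply: czg; apply: (subsetP sGu).
  by rewrite ey -expgM mulnC expgM -oz expg_order expg1n mulg1.
by move: sgp; rewrite egp; apply/subsetP; rewrite cycle_subG mem_cycle.
Qed.

Lemma power_nbhd_lower_bound2 G p q r u v w s t x z :
  prime p -> q != p -> r != p -> q != r ->
  u \in G -> v \in G -> w \in G ->
  commute u v -> commute u w -> commute v w ->
  p.-elt u -> q.-elt v -> r.-elt w ->
  s \in <[u]> -> t \in <[v]> -> x \in <[w]> ->
  z \in 'Z(G) -> #[z] = p -> z \notin <[u]> ->
  (#[s] * (#[t] * #[x])
     + p * (#[u] - #[s]) * (#|cycle_above v t| * #|cycle_above w x|)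
    <= #|power_nbhd G (s * (t * x))|)%N.
Proof.
move=> pr_p qp rp qr Gu Gv Gw cuv cuw cvw pu qv rw us vt wx Zz oz zu.
have covw : coprime #[v] #[w].
  apply: pnat_coprime qv _.
  by apply: sub_in_pnat rw => k _ /eqnP->; rewrite !inE eq_sym.
have cotx : coprime #[t] #[x].
  apply: coprime_dvdl (order_dvdG vt) _.
  by apply: coprime_dvdr (order_dvdG wx) _; rewrite -!orderE.
have p'vw : p^'.-elt (v * w).
  rewrite /p_elt orderM // pnatM; apply/andP; split.
    by apply: sub_in_pnat qv => k _ /eqnP->; rewrite !inE.
  by apply: sub_in_pnat rw => k _ /eqnP->; rewrite !inE.
rewrite -orderM //; last exact: commute_cycles cvw vt wx.
apply: leq_trans (power_nbhd_lower_bound pr_p Gu (groupM Gv Gw) (commuteM cuv cuw)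
  pu p'vw us _ Zz oz zu); last by rewrite cycleM // mem_mulg.
by rewrite leq_add2l leq_mul2l cycle_aboveM ?orbT.
Qed.

Lemma order_pelt_cases p u s : prime p -> p.-elt u -> s \in <[u]> ->
  #[s] = #[u] \/ (p * #[s] <= #[u])%N.
Proof.
move=> pr_p pu us; have ps := mem_p_elt pu us.
have [a oa] := p_natP ps; have [b ob] := p_natP pu.
have := order_dvdG us; rewrite -orderE oa ob dvdn_Pexp2l ?prime_gt1 //.
rewrite leq_eqVlt => /orP[/eqP->|lt_ab]; [by left | right].
by rewrite -expnS leq_exp2l ?prime_gt1.
Qed.

Lemma exists_central_prime_order G (P : {group gT}) p w :
  prime p -> nilpotent G -> p.-Sylow(G) P ->
  ~~ cyclic 'Z(P) -> exists z, [/\ z \in 'Z(G), #[z] = p & z \notin <[w]>].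
Proof.
move=> pr_p nilG sylP ncZ.
have sZ : 'Z(P) \subset 'Z(G).
  have eP := nilpotent_Hall_pcore nilG sylP.
  have /center_dprod/dprodW <- := nilpotent_pcoreC p nilG.
  by rewrite eP mulG_subl.
have pZ : p.-group 'Z(P) := pgroupS (center_sub P) (pHall_pgroup sylP).
have [/subsetP sO|/subsetPn[z]] := boolP ('Ohm_1('Z(P)) \subset <[w]>).
  case/negP: ncZ.
  rewrite abelian_rank1_cyclic ?center_abelian // (rank_pgroup pZ) -p_rank_Ohm1.
  rewrite -(rank_pgroup (pgroupS (Ohm_sub 1 _) pZ)) -abelian_rank1_cyclic.
    by apply: cyclicS (cycle_cyclic w); apply/subsetP.
  by apply: abelianS (Ohm_sub 1 _) (center_abelian P).
rewrite (OhmEabelian pZ) ?(abelianS (Ohm_sub 1 _) (center_abelian P)) //.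
case/LdivP=> Zz zp wz; exists z; split=> //; first exact: (subsetP sZ).
apply: nt_prime_order => //.
by apply: contraNneq wz => ->; apply: group1.
Qed.

End CyclicCounting.

Lemma leq_sub_ratio p m q L e : (0 < m)%N -> (m <= p)%N -> (e <= q)%N ->
  (p * (q - L) <= e)%N -> ((m - 1) * q <= m * L)%N.
Proof. nia. Qed.

Lemma prod_leq_count_bounds p1 p2 p3 q1 q2 q3 e1 e2 e3 L1 L2 L3 D :
  (1 < p1)%N -> (2 < p2)%N -> (4 < p3)%N ->
  (p1 * (q1 - L1) <= e1)%N -> (p2 * (q2 - L2) <= e2)%N ->
  (p3 * (q3 - L3) <= e3)%N ->
  e1 = q1 \/ (p1 * e1 <= q1)%N -> e2 = q2 \/ (p2 * e2 <= q2)%N ->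
  e3 = q3 \/ (p3 * e3 <= q3)%N ->
  (e1 * (e2 * e3) + p1 * (q1 - e1) * (L2 * L3) <= D)%N ->
  (e2 * (e1 * e3) + p2 * (q2 - e2) * (L1 * L3) <= D)%N ->
  (e3 * (e1 * e2) + p3 * (q3 - e3) * (L1 * L2) <= D)%N ->
  (q1 * (q2 * q3) <= D)%N.
Proof.
move=> hp1 hp2 hp3 hL1 hL2 hL3 h1 h2 h3 D1 D2 D3.
have le1 : (e1 <= q1)%N by case: h1; nia.
have le2 : (e2 <= q2)%N by case: h2; nia.
have le3 : (e3 <= q3)%N by case: h3; nia.
have r1 : (q1 <= 2 * L1)%N.
  by have := @leq_sub_ratio p1 2 q1 L1 e1 isT hp1 le1 hL1; lia.
have r2 : (2 * q2 <= 3 * L2)%N.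
  by have := @leq_sub_ratio p2 3 q2 L2 e2 isT hp2 le2 hL2; lia.
have r3 : (4 * q3 <= 5 * L3)%N.
  by have := @leq_sub_ratio p3 5 q3 L3 e3 isT hp3 le3 hL3; lia.
case: h3 => [E3|lt3]; last first.
  have a3 : (4 * q3 <= p3 * (q3 - e3))%N by nia.
  have m12 : (q1 * (2 * q2) <= 2 * L1 * (3 * L2))%N by apply: leq_mul.
  have := leq_mul a3 m12; nia.
case: h2 => [E2|lt2].
  have m23 : ((2 * q2) * (4 * q3) <= (3 * L2) * (5 * L3))%N by apply: leq_mul.
  have a23 : (q2 * q3 <= p1 * (L2 * L3))%N by nia.
  have := leq_mul (leqnn (q1 - e1)) a23; subst; nia.
have a2 : (2 * q2 <= p2 * (q2 - e2))%N by nia.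
case: h1 => [E1|lt1].
  have m13 : (q1 * (4 * q3) <= (2 * L1) * (5 * L3))%N by apply: leq_mul.
  have a13 : (q1 * q3 <= p2 * (L1 * L3))%N by nia.
  have := leq_mul (leqnn (q2 - e2)) a13; subst; nia.
have b1 : (3 * q1 <= 4 * L1)%N by nia.
have m13 : ((3 * q1) * (4 * q3) <= (4 * L1) * (5 * L3))%N by apply: leq_mul.
have := leq_mul a2 m13; nia.
Qed.

Theorem theorem1p3 (gT : finGroupType) (G P1 P2 P3 : {group gT})
    (p1 p2 p3 a1 a2 a3 : nat)
    (Gnil : nilpotent G) (Gnc : ~~ cyclic G)
    (pr1 : prime p1) (pr2 : prime p2) (pr3 : prime p3)
    (lt12 : (p1 < p2)%N) (lt23 : (p2 < p3)%N)
    (a1_ge1 : (1 <= a1)%N) (a2_ge1 : (1 <= a2)%N) (a3_ge1 : (1 <= a3)%N)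
    (oG : #|G| = (p1 ^ a1 * p2 ^ a2 * p3 ^ a3)%N)
    (sylP1 : p1.-Sylow(G) P1) (sylP2 : p2.-Sylow(G) P2)
    (sylP3 : p3.-Sylow(G) P3)
    (Z1nc : ~~ cyclic 'Z(P1)) (Z2nc : ~~ cyclic 'Z(P2))
    (Z3nc : ~~ cyclic 'Z(P3))
    (y : gT) (My : <[y]>%G \in max_cyclics G)
    (y_min : forall M : {group gT}, M \in max_cyclics G -> (#|<[y]>| <= #|M|)%N) :
  power_min_deg G = power_deg G y.
Proof.
have Gy : y \in G.
  by move: My; rewrite inE => /maxgroupp/andP[]; rewrite cycle_subG.
have p1_gt1 := prime_gt1 pr1.
have p2_gt2 : (2 < p2)%N := leq_ltn_trans p1_gt1 lt12.
have p3_gt4 : (4 < p3)%N.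
  have: (3 < p3)%N := leq_ltn_trans p2_gt2 lt23.
  by rewrite leq_eqVlt => /orP[/eqP e|//]; rewrite -e in pr3.
have key x : x \in G -> (#|<[y]>| <= #|power_nbhd G x|)%N.
  move=> Gx; have [w [Mw Gw /cycleP[k ex]]] := max_cyclics_above Gx.
  apply: leq_trans (y_min _ Mw) _; rewrite /= -orderE.
  pose w1 := w.`_p1; pose w' := w.`_p1^'.
  pose w2 := w'.`_p2; pose w3 := w'.`_p2^'.
  have ww' : w' \in <[w]> := cycle_constt _ _.
  have ww1 : w1 \in <[w]> := cycle_constt _ _.
  have sw' : <[w']> \subset <[w]> by rewrite cycle_subG.
  have ww2 : w2 \in <[w]> := subsetP sw' _ (cycle_constt _ _).
  have ww3 : w3 \in <[w]> := subsetP sw' _ (cycle_constt _ _).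
  have sGw : <[w]> \subset G by rewrite cycle_subG.
  have G1 := subsetP sGw _ ww1.
  have G2 := subsetP sGw _ ww2.
  have G3 := subsetP sGw _ ww3.
  have P1w : p1.-elt w1 := p_elt_constt _ _.
  have P2w : p2.-elt w2 := p_elt_constt _ _.
  have P3w : p3.-elt w3.
    have p1'w3 : p1^'.-elt w3 := mem_p_elt (p_elt_constt _ _) (cycle_constt _ _).
    have p2'w3 : p2^'.-elt w3 := p_elt_constt _ _.
    apply: (@pnat_dvd _ (p3 ^ a3)); last by rewrite pnatX pnat_id.
    rewrite -(@Gauss_dvdr _ (p1 ^ a1 * p2 ^ a2)) -?oG ?order_dvdG //.
    rewrite coprimeMr; apply/andP; split.
      by apply: p'nat_coprime p1'w3 _; rewrite pnatX pnat_id.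
    by apply: p'nat_coprime p2'w3 _; rewrite pnatX pnat_id.
  have cw u v : u \in <[w]> -> v \in <[w]> -> commute u v.
    exact: commute_cycles (commute_refl w).
  have exw : x = w1 ^+ k * (w2 ^+ k * w3 ^+ k).
    rewrite -(expgMn _ (cw _ _ ww2 ww3)) consttC.
    by rewrite -(expgMn _ (cw _ _ ww1 ww')) consttC.
  have m1 : w1 ^+ k \in <[w1]> by exact: mem_cycle.
  have m2 : w2 ^+ k \in <[w2]> by exact: mem_cycle.
  have m3 : w3 ^+ k \in <[w3]> by exact: mem_cycle.
  have [z1 [Zz1 oz1 nz1]] := exists_central_prime_order w1 pr1 Gnil sylP1 Z1nc.
  have [z2 [Zz2 oz2 nz2]] := exists_central_prime_order w2 pr2 Gnil sylP2 Z2nc.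
  have [z3 [Zz3 oz3 nz3]] := exists_central_prime_order w3 pr3 Gnil sylP3 Z3nc.
  have n12 : p1 != p2 by rewrite ltn_eqF.
  have n23 : p2 != p3 by rewrite ltn_eqF.
  have n13 : p1 != p3 by rewrite ltn_eqF // (ltn_trans lt12).
  have n21 : p2 != p1 by rewrite eq_sym.
  have n32 : p3 != p2 by rewrite eq_sym.
  have n31 : p3 != p1 by rewrite eq_sym.
  have D1 := power_nbhd_lower_bound2 pr1 n21 n31 n23 G1 G2 G3 (cw _ _ ww1 ww2)
    (cw _ _ ww1 ww3) (cw _ _ ww2 ww3) P1w P2w P3w m1 m2 m3 Zz1 oz1 nz1.
  have D2 := power_nbhd_lower_bound2 pr2 n12 n32 n13 G2 G1 G3 (cw _ _ ww2 ww1)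
    (cw _ _ ww2 ww3) (cw _ _ ww1 ww3) P2w P1w P3w m2 m1 m3 Zz2 oz2 nz2.
  have D3 := power_nbhd_lower_bound2 pr3 n13 n23 n12 G3 G1 G2 (cw _ _ ww3 ww1)
    (cw _ _ ww3 ww2) (cw _ _ ww1 ww2) P3w P1w P2w m3 m1 m2 Zz3 oz3 nz3.
  have wX u : u \in <[w]> -> u ^+ k \in <[w]> by exact: groupX.
  have E2 : w2 ^+ k * (w1 ^+ k * w3 ^+ k) = x.
    by rewrite exw mulgA (cw (w2 ^+ k) (w1 ^+ k)) ?wX // -mulgA.
  have E3 : w3 ^+ k * (w1 ^+ k * w2 ^+ k) = x.
    by rewrite exw (cw (w3 ^+ k)) ?groupM ?wX // -mulgA.
  rewrite -exw in D1; rewrite E2 in D2; rewrite E3 in D3.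
  apply: leq_trans (prod_leq_count_bounds p1_gt1 p2_gt2 p3_gt4
    (card_cycle_above pr1 P1w m1) (card_cycle_above pr2 P2w m2)
    (card_cycle_above pr3 P3w m3) (order_pelt_cases pr1 P1w m1)
    (order_pelt_cases pr2 P2w m2) (order_pelt_cases pr3 P3w m3) D1 D2 D3).
  have ow' : (#[w2] * #[w3])%N = #[w'].
    by rewrite [#[w2]]order_constt [#[w3]]order_constt partnC.
  by rewrite ow' [#[w1]]order_constt order_constt partnC.
rewrite /power_min_deg; case: arg_minnP => [|x Gx xmin]; first exact: group1.
apply/eqP; rewrite eqn_leq xmin //= -ltnS !power_degS //.
by rewrite power_nbhd_max // key.
Qed.
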